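(* Let $\gamma$ be an $s$-curve with modulus $\mathbf e=(e_1,e_2,e_3)$, with curvature $k$ of least period $\omega$, and put $$\Phi_1(\mathbf e)=\frac1{2\pi}\int_0^\omega k\,ds,\qquad \Phi_2(\mathbf e)=\frac1{2\pi}\int_0^\omega\Lambda\,ds,\qquad \Lambda=\frac{16(4-a)+(b+4\lambda)k}{4(8k+4\lambda+b)} .$$ Then $\gamma$ is closed (i.e. periodic) if and only if $(\Phi_1(\mathbf e),\Phi_2(\mathbf e))\in\mathbb Q^2$.
   Context: $S^3\subset\mathbb C^2$ is the set of unit vectors for the standard Hermitian inner product $\langle\cdot,\cdot\rangle$ (linear in the first slot). A unit-speed Legendrian curve is a smooth $\gamma:\mathbb R\to S^3$ with $\langle\gamma_s,\gamma\rangle=0$, $\langle\gamma_s,\gamma_s\rangle=1$; its curvature is $k=\mathrm{Im}\langle\gamma_{ss},\gamma_s\rangle$. An $s$-curve is a unit-speed Legendrian curve whose curvature $k$ is a non-constant periodic solution of $k'''+\frac32k^2k'+ak'=0$ for some $a\in\mathbb R$. Then there are constants $b,c\in\mathbb R$ with $k''+\frac12k^3+ak+\frac12b=0$ and $(k')^2+P_{a,b,c}(k)=0$, where $P_{a,b,c}(x)=\frac14x^4+ax^2+bx+c$. Two cases are considered: the dnoidal case, where $P_{a,b,c}$ has four distinct real roots $e_1>e_2>e_3>e_4=-(e_1+e_2+e_3)$; and the cnoidal case, where $P_{a,b,c}$ has exactly two distinct real roots $e_1>e_2$ and complex conjugate roots $-\frac12(e_1+e_2)\pm\mathrm i e_3$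 with $e_3>0$. In each case $\mathbf e=(e_1,e_2,e_3)$ is called the modulus, and it determines $a,b,c$. By translating $s$ and reversing the orientation of $\gamma$ if necessary one normalizes $k(0)=e_2$ (so $k'(0)=0$ and $k$ oscillates between $e_2$ and $e_1$); with this normalization $\mathbf e$ determines $k$. The constant $\lambda$ is $$\lambda=\tfrac14\sqrt{256-128a+16a^2+b^2-16c}>0 .$$ If $8e_2+4\lambda+b=0$, the denominator of $\Lambda$ vanishes only at isolated values of $s$, and $\Lambda$ is extended continuously there. *)

(* Defs.v *)
From Stdlib Require Import Reals.
From Coquelicot Require Import Coquelicot.

Open Scope R_scope.

Definition C2 : Type := (C * C)%type.

Definition herm (z w : C2) : C :=
  (fst z * Cconj (fst w) + snd z * Cconj (snd w))%C.

Definition smooth (f : R -> C) : Prop :=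
  forall (n : nat) (s : R),
    ex_derive_n (fun t => Re (f t)) n s /\ ex_derive_n (fun t => Im (f t)) n s.

Definition smooth2 (g : R -> C2) : Prop :=
  smooth (fun s => fst (g s)) /\ smooth (fun s => snd (g s)).

Definition CDerive (f : R -> C) (s : R) : C :=
  (Derive (fun t => Re (f t)) s, Derive (fun t => Im (f t)) s).

Definition C2Derive (g : R -> C2) (s : R) : C2 :=
  (CDerive (fun t => fst (g t)) s, CDerive (fun t => snd (g t)) s).

Definition unit_speed_legendrian (g : R -> C2) : Prop :=
  smooth2 g /\
  forall s : R,
    herm (g s) (g s) = 1 /\
    herm (C2Derive g s) (g s) = 0 /\
    herm (C2Derive g s) (C2Derive g s) = 1.

Definition curvature (g : R -> C2) (s : R) : R :=
  Im (herm (C2Derive (C2Derive g) s) (C2Derive g s)).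

Definition period {T : Type} (f : R -> T) (w : R) : Prop :=
  0 < w /\ forall s : R, f (s + w) = f s.

Definition periodic {T : Type} (f : R -> T) : Prop :=
  exists w : R, period f w.

Definition least_period {T : Type} (f : R -> T) (w : R) : Prop :=
  period f w /\ forall t : R, period f t -> w <= t.

Definition s_curve (g : R -> C2) : Prop :=
  unit_speed_legendrian g /\
  let k := curvature g in
  periodic k /\
  (exists s t : R, k s <> k t) /\
  exists a : R, forall s : R,
    Derive_n k 3 s + 3 / 2 * k s ^ 2 * Derive k s + a * Derive k s = 0.

Definition P (a b c x : R) : R := / 4 * x ^ 4 + a * x ^ 2 + b * x + c.

Definition PC (a b c : R) (z : C) : C :=
  (RtoC (/ 4) * z ^ 4 + RtoC a * z ^ 2 + RtoC b * z + RtoC c)%C.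

Definition dnoidal (a b c e1 e2 e3 : R) : Prop :=
  let e4 := - (e1 + e2 + e3) in
  e1 > e2 /\ e2 > e3 /\ e3 > e4 /\
  P a b c e1 = 0 /\ P a b c e2 = 0 /\ P a b c e3 = 0 /\ P a b c e4 = 0.

Definition cnoidal (a b c e1 e2 e3 : R) : Prop :=
  e1 > e2 /\ e3 > 0 /\
  (forall x : R, P a b c x = 0 <-> x = e1 \/ x = e2) /\
  PC a b c (- / 2 * (e1 + e2), e3) = 0 /\
  PC a b c (- / 2 * (e1 + e2), - e3) = 0.

(** [k] is a normalized curvature function ([k 0 = e2]) of modulus
    [(e1, e2, e3)], with associated constants [a], [b], [c]. *)
Definition has_modulus (k : R -> R) (a b c e1 e2 e3 : R) : Prop :=
  (forall s : R, Derive_n k 2 s + / 2 * k s ^ 3 + a * k s + / 2 * b = 0) /\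
  (forall s : R, Derive k s ^ 2 + P a b c (k s) = 0) /\
  (dnoidal a b c e1 e2 e3 \/ cnoidal a b c e1 e2 e3) /\
  k 0 = e2.

(** [g0] is [g] up to a translation of the parameter and possibly a reversal
    of orientation; these are the changes of parameter by which an s-curve is
    brought into the normalization [k 0 = e2]. *)
Definition reparametrization (g g0 : R -> C2) : Prop :=
  exists s0 : R,
    (forall s : R, g0 s = g (s0 + s)) \/ (forall s : R, g0 s = g (s0 - s)).

Definition lambda (a b c : R) : R :=
  / 4 * sqrt (256 - 128 * a + 16 * a ^ 2 + b ^ 2 - 16 * c).

Definition Lambda_den (a b c : R) (k : R -> R) (s : R) : R :=
  4 * (8 * k s + 4 * lambda a b c + b).

Definition Lambda_quot (a b c : R) (k : R -> R) (s : R) : R :=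
  (16 * (4 - a) + (b + 4 * lambda a b c) * k s) / Lambda_den a b c k s.

(** [Lim] is the limit over the punctured neighbourhood, so at a zero of the
    denominator this is the value of the continuous extension. *)
Definition Lambda (a b c : R) (k : R -> R) (s : R) : R :=
  if Req_EM_T (Lambda_den a b c k s) 0
  then real (Lim (Lambda_quot a b c k) s)
  else Lambda_quot a b c k s.

Definition Phi1 (k : R -> R) (w : R) : R :=
  / (2 * PI) * RInt k 0 w.

Definition Phi2 (a b c : R) (k : R -> R) (w : R) : R :=
  / (2 * PI) * RInt (Lambda a b c k) 0 w.

Definition rational (x : R) : Prop := exists q : QArith_base.Q, x = Q2R q.

(* Main.v *)
Require Import Defs.
From Stdlib Require Import Reals Lra Lia Psatz Arith Classical.
From Coquelicot Require Import Coquelicot.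

Open Scope R_scope.

(** The coordinates of a unit-speed Legendrian curve of curvature [k] solve the
    linear equation [u'' = i k u' - u] ([legendrian_frame]).  A period of the
    curve is a multiple [n omega] of the least period of [k], and the curve is
    closed exactly when some power of the monodromy of this equation over
    [omega], a unitary matrix, is the identity, that is, when its two
    eigenvalues are roots of unity.

    The equation for [k] is a stationary modified Korteweg-de Vries equation:
    there is a matrix, polynomial in [k] and [k'], with constant eigenvalues
    [i lambda] and [- i lambda], which commutes with the monodromy.  Following
    the eigenvector of [i lambda], normalized to a solution, gives the solution
    [sqrt p * exp (i * integral of mu)] with [p = 2 k + b / 4 + lambda] and
    [mu p = k^2 / 2 + a - 4].  An elementary computation turns the second
    equation into [mu = k / 4 - Lambda].  So one eigenvalue of the monodromy is
    [exp (2 pi i (Phi1 / 4 - Phi2))], up to sign if [p] has zeros, and the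
    determinant is [exp (2 pi i Phi1)], since the trace of the equation is
    [i k].  Both eigenvalues are roots of unity if and only if [Phi1] and
    [Phi2] are rational.

    The zeros of [p], which are the zeros of the denominator of [Lambda], are
    the one difficulty: there the eigenvector degenerates and [sqrt p] changes
    branch.  Two devices treat all cases together.  First, [exists_phase_rate]
    provides a smooth [mu] also when [p] has zeros; it is then affine in [k].
    Second, the special solution is replaced by its tensor square, which is
    smooth across the zeros and is insensitive to the sign of the square root
    ([flow_weights]).  Contracting it with the coordinates of the curve gives
    conserved quantities ([pairing_constant]), which together with the
    determinant of the frame ([wronskian_phase]) determine the curve up to sign.
    Comparing them at [s] and [s + n omega] yields both implications
    ([closed_phases] and [phases_closed]). *)

(** * Curves in the complex plane *)

(** Coordinatewise, so that real differentiation rules apply directly and the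
    derivative agrees with [CDerive]. *)
Definition is_cderive (f : R -> C) (s : R) (l : C) : Prop :=
  is_derive (fun t => Re (f t)) s (Re l) /\
  is_derive (fun t => Im (f t)) s (Im l).

Definition cis (t : R) : C := (cos t, sin t).

Lemma is_derive_eq (f : R -> R) (s l m : R) :
  is_derive f s l -> l = m -> is_derive f s m.
Proof. now intros H <-. Qed.

Lemma is_cderive_eq (f : R -> C) (s : R) (l m : C) :
  is_cderive f s l -> l = m -> is_cderive f s m.
Proof. now intros H <-. Qed.

Lemma is_cderive_CDerive (f : R -> C) (s : R) :
  ex_derive (fun t => Re (f t)) s -> ex_derive (fun t => Im (f t)) s ->
  is_cderive f s (CDerive f s).
Proof. intros Hr Hi; split; now apply Derive_correct. Qed.

Lemma is_cderive_pair (f g : R -> R) (s l m : R) :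
  is_derive f s l -> is_derive g s m ->
  is_cderive (fun t => (f t, g t)) s (l, m).
Proof. now split. Qed.

Lemma is_cderive_const (c : C) (s : R) : is_cderive (fun _ => c) s 0%C.
Proof. split; exact (is_derive_const _ _). Qed.

Lemma is_cderive_unique (f : R -> C) (s : R) (l m : C) :
  is_cderive f s l -> is_cderive f s m -> l = m.
Proof.
  intros [H1 H2] [H3 H4]; apply injective_projections.
  - transitivity (Derive (fun t => Re (f t)) s);
      [ symmetry |]; now apply is_derive_unique.
  - transitivity (Derive (fun t => Im (f t)) s);
      [ symmetry |]; now apply is_derive_unique.
Qed.

Lemma is_cderive_ext (f g : R -> C) (s : R) (l : C) :
  (forall t, f t = g t) -> is_cderive f s l -> is_cderive g s l.
Proof.
  intros E [H1 H2]; split;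
    [ apply (is_derive_ext (fun t => Re (f t)))
    | apply (is_derive_ext (fun t => Im (f t))) ]; trivial; intros t; now rewrite E.
Qed.

Lemma is_cderive_plus (f g : R -> C) (s : R) (l m : C) :
  is_cderive f s l -> is_cderive g s m ->
  is_cderive (fun t => f t + g t)%C s (l + m)%C.
Proof.
  intros [Hf Hf'] [Hg Hg'].
  split; [ apply (is_derive_plus (fun t => Re (f t)) (fun t => Re (g t)))
         | apply (is_derive_plus (fun t => Im (f t)) (fun t => Im (g t))) ];
  assumption.
Qed.

Lemma is_cderive_minus (f g : R -> C) (s : R) (l m : C) :
  is_cderive f s l -> is_cderive g s m ->
  is_cderive (fun t => f t - g t)%C s (l - m)%C.
Proof.
  intros [Hf Hf'] [Hg Hg'].
  split; [ apply (is_derive_minus (fun t => Re (f t)) (fun t => Re (g t)))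
         | apply (is_derive_minus (fun t => Im (f t)) (fun t => Im (g t))) ];
  assumption.
Qed.

Lemma is_cderive_mult (f g : R -> C) (s : R) (l m : C) :
  is_cderive f s l -> is_cderive g s m ->
  is_cderive (fun t => f t * g t)%C s (l * g s + f s * m)%C.
Proof.
  intros [Hf Hf'] [Hg Hg'].
  assert (rr : forall (u v : R -> R) (a b : R),
    is_derive u s a -> is_derive v s b ->
    is_derive (fun t => u t * v t) s (a * v s + u s * b)).
  { intros u v a b Hu Hv.
    apply (is_derive_mult u v s a b Hu Hv); intros; apply Rmult_comm. }
  split.
  - apply (is_derive_eq _ _ (minus (Re l * Re (g s) + Re (f s) * Re m)
                                   (Im l * Im (g s) + Im (f s) * Im m))).
    + apply (is_derive_minus (fun t => Re (f t) * Re (g t))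
                             (fun t => Im (f t) * Im (g t))); now apply rr.
    + unfold minus, plus, opp, Re, Im; simpl; ring.
  - apply (is_derive_eq _ _ (plus (Re l * Im (g s) + Re (f s) * Im m)
                                  (Im l * Re (g s) + Im (f s) * Re m))).
    + apply (is_derive_plus (fun t => Re (f t) * Im (g t))
                            (fun t => Im (f t) * Re (g t))); now apply rr.
    + unfold plus, Re, Im; simpl; ring.
Qed.

Lemma is_cderive_conj (f : R -> C) (s : R) (l : C) :
  is_cderive f s l -> is_cderive (fun t => Cconj (f t)) s (Cconj l).
Proof. intros [Hf Hf'];
  split; [ exact Hf | exact (is_derive_opp (fun t => Im (f t)) s _ Hf') ].
Qed.

Lemma is_cderive_cis (th : R -> R) (s l : R) :
  is_derive th s l ->
  is_cderive (fun t => cis (th t)) s (Ci * l * cis (th s))%C.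
Proof.
  intros H; split.
  - apply (is_derive_eq _ _ (scal l (- sin (th s)))).
    + apply (is_derive_comp cos th); [ apply is_derive_cos | exact H ].
    + unfold scal; simpl; unfold mult; simpl; ring.
  - apply (is_derive_eq _ _ (scal l (cos (th s)))).
    + apply (is_derive_comp sin th); [ apply is_derive_sin | exact H ].
    + unfold scal; simpl; unfold mult; simpl; ring.
Qed.

Lemma is_derive_shift (f : R -> R) (T s l : R) :
  is_derive f (s + T) l -> is_derive (fun t => f (t + T)) s l.
Proof.
  intros H; apply (is_derive_eq _ _ (scal 1 l)).
  - apply (is_derive_comp f (fun t => t + T)); [ exact H | auto_derive; trivial ].
  - unfold scal; simpl; unfold mult; simpl; ring.
Qed.

Lemma is_cderive_shift (f : R -> C) (T s : R) (l : C) :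
  is_cderive f (s + T) l -> is_cderive (fun t => f (t + T)) s l.
Proof.
  intros [H H']; split.
  - exact (is_derive_shift (fun t => Re (f t)) T s (Re l) H).
  - exact (is_derive_shift (fun t => Im (f t)) T s (Im l) H').
Qed.

Lemma derive_0_constant (f : R -> R) :
  (forall s, is_derive f s 0) -> forall s t, f s = f t.
Proof.
  intros H s t.
  destruct (MVT_gen f s t (fun _ => 0)) as [x [_ Hx]].
  - intros; apply H.
  - intros u _. apply derivable_continuous_pt. exists 0. now apply is_derive_Reals.
  - lra.
Qed.

Lemma cderive_0_constant (f : R -> C) :
  (forall s, is_cderive f s 0%C) -> forall s t, f s = f t.
Proof.
  intros H s t; apply injective_projections.
  - apply (derive_0_constant (fun u => Re (f u))); intros u; apply H.
  - apply (derive_0_constant (fun u => Im (f u))); intros u; apply H.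
Qed.

Lemma cis_plus (s t : R) : cis (s + t) = (cis s * cis t)%C.
Proof.
  apply injective_projections; simpl; [ apply cos_plus | rewrite sin_plus; ring ].
Qed.

Lemma cis_conj (t : R) : (cis t * Cconj (cis t) = 1)%C.
Proof.
  pose proof (sin2_cos2 t); unfold Rsqr in *.
  apply injective_projections; simpl; [ lra | ring ].
Qed.

Lemma cis_neq_0 (t : R) : cis t <> 0%C.
Proof.
  intros H; pose proof (cis_conj t) as E; rewrite H in E.
  apply (f_equal fst) in E; simpl in E; lra.
Qed.

Lemma cis_eq_1 (t : R) : cis t = 1%C <-> exists m : Z, t = IZR m * (2 * PI).
Proof.
  pose proof (cos_2a_sin (t / 2)) as D.
  pose proof (sin_2a (t / 2)) as D'.
  replace (2 * (t / 2)) with t in D, D' by field.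
  split.
  - intros H; apply (f_equal fst) in H; simpl in H.
    destruct (sin_eq_0_0 (t / 2)) as [m Hm]; [ nra |].
    exists m; lra.
  - intros [m Hm].
    assert (sin (t / 2) = 0) as Z by (apply sin_eq_0_1; exists m; lra).
    rewrite Z in D, D'.
    apply injective_projections; simpl; lra.
Qed.

(** * Smooth functions *)

Definition rsmooth (f : R -> R) : Prop := forall (n : nat) (s : R), ex_derive_n f n s.

Lemma rsmooth_ex_derive (f : R -> R) : rsmooth f -> forall s, ex_derive f s.
Proof. intros H s; exact (H 1%nat s). Qed.

(** [Derive_n] recurses on the outermost derivative; this lemma and
    [ex_derive_n_S] split off the innermost one. *)
Lemma rsmooth_Derive (f : R -> R) : rsmooth f -> rsmooth (Derive f).
Proof.
  intros H [| n] s; [ exact I |].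
  apply (ex_derive_ext (Derive_n f (S n))); [| exact (H (S (S n)) s) ].
  intros t; rewrite <- Nat.add_1_r; symmetry; exact (Derive_n_comp f n 1 t).
Qed.

Lemma ex_derive_n_S (f : R -> R) (n : nat) :
  (forall s, ex_derive f s) -> (forall s, ex_derive_n (Derive f) n s) ->
  forall s, ex_derive_n f (S n) s.
Proof.
  intros H0 H; destruct n as [| n]; [ exact H0 |].
  intros s; apply (ex_derive_ext (Derive_n (Derive f) n)); [| exact (H s) ].
  intros t; rewrite <- Nat.add_1_r; exact (Derive_n_comp f n 1 t).
Qed.

Lemma rsmooth_plus (f g : R -> R) :
  rsmooth f -> rsmooth g -> rsmooth (fun s => f s + g s).
Proof. intros Hf Hg n s; apply ex_derive_n_plus; apply filter_forall; auto. Qed.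

Lemma rsmooth_minus (f g : R -> R) :
  rsmooth f -> rsmooth g -> rsmooth (fun s => f s - g s).
Proof. intros Hf Hg n s; apply ex_derive_n_minus; apply filter_forall; auto. Qed.

Lemma rsmooth_opp (f : R -> R) : rsmooth f -> rsmooth (fun s => - f s).
Proof. intros Hf n s; now apply ex_derive_n_opp. Qed.

Lemma rsmooth_mult (f g : R -> R) :
  rsmooth f -> rsmooth g -> rsmooth (fun s => f s * g s).
Proof.
  intros Hf Hg n; revert f g Hf Hg.
  induction n as [n IH] using lt_wf_ind; intros f g Hf Hg.
  destruct n as [| n]; [ intros s; exact I |].
  pose proof (rsmooth_ex_derive _ Hf) as Ef; pose proof (rsmooth_ex_derive _ Hg) as Eg.
  apply ex_derive_n_S.
  - intros s; now apply ex_derive_mult.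
  - intros s.
    apply (ex_derive_n_ext (fun t => Derive f t * g t + f t * Derive g t)).
    + intros t; symmetry; now apply Derive_mult.
    + apply ex_derive_n_plus; apply filter_forall; intros t m Hm;
        apply IH; auto using rsmooth_Derive; lia.
Qed.

Lemma is_derive_affine (f : R -> R) (s0 e s l : R) :
  is_derive f (s0 + e * s) l -> is_derive (fun t => f (s0 + e * t)) s (e * l).
Proof.
  intros H; apply (is_derive_eq _ _ (scal e l)); [| reflexivity ].
  apply (is_derive_comp f (fun t => s0 + e * t)); [ exact H | auto_derive; trivial; ring ].
Qed.

Lemma rsmooth_affine (f : R -> R) (s0 e : R) :
  rsmooth f -> rsmooth (fun s => f (s0 + e * s)).
Proof.
  intros Hf n; revert f Hf.
  induction n as [| n IH]; intros f Hf; [ intros s; exact I |].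
  pose proof (rsmooth_ex_derive _ Hf) as Ef.
  assert (D : forall s, is_derive (fun t => f (s0 + e * t)) s (e * Derive f (s0 + e * s)))
    by (intros s; apply is_derive_affine, Derive_correct, Ef).
  apply ex_derive_n_S.
  - intros s; eexists; apply D.
  - intros s.
    apply (ex_derive_n_ext (fun t => e * Derive f (s0 + e * t))).
    + intros t; symmetry; apply is_derive_unique, D.
    + apply ex_derive_n_scal_l, IH, rsmooth_Derive, Hf.
Qed.

(** * Legendrian curves *)

Lemma CDerive_affine (f : R -> C) (s0 e : R) :
  smooth f -> forall s,
  CDerive (fun t => f (s0 + e * t)) s = (e * CDerive f (s0 + e * s))%C.
Proof.
  intros Hf s; destruct (Hf 1%nat (s0 + e * s)) as [Hr Hi].
  apply injective_projections; simpl.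
  - transitivity (e * Derive (fun t => Re (f t)) (s0 + e * s)); [| ring ].
    apply is_derive_unique, (is_derive_affine (fun t => Re (f t))), Derive_correct, Hr.
  - transitivity (e * Derive (fun t => Im (f t)) (s0 + e * s)); [| ring ].
    apply is_derive_unique, (is_derive_affine (fun t => Im (f t))), Derive_correct, Hi.
Qed.

Lemma reparametrization_affine (g g0 : R -> C2) :
  reparametrization g g0 ->
  exists s0 e : R, e * e = 1 /\ forall s, g0 s = g (s0 + e * s).
Proof.
  intros [s0 [H | H]].
  - exists s0, 1; split; [ ring | intros s; rewrite H; f_equal; ring ].
  - exists s0, (-1); split; [ ring | intros s; rewrite H; f_equal; ring ].
Qed.

Lemma legendrian_affine (g g0 : R -> C2) (s0 e : R) :
  e * e = 1 -> (forall s, g0 s = g (s0 + e * s)) ->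
  unit_speed_legendrian g -> unit_speed_legendrian g0.
Proof.
  intros He E [[S1 S2] U].
  assert (rsm : forall f : R -> C, smooth f -> smooth (fun s => f (s0 + e * s))).
  { intros f Hf n s; split.
    - apply (rsmooth_affine (fun t => Re (f t))); intros m t; apply Hf.
    - apply (rsmooth_affine (fun t => Im (f t))); intros m t; apply Hf. }
  assert (ext : forall (f h : R -> C), (forall s, f s = h s) -> smooth f -> smooth h).
  { intros f h Efh Hf n s; destruct (Hf n s) as [Hr Hi]; split.
    - apply (ex_derive_n_ext (fun t => Re (f t))); [ intros t; now rewrite Efh | exact Hr ].
    - apply (ex_derive_n_ext (fun t => Im (f t))); [ intros t; now rewrite Efh | exact Hi ]. }
  assert (D : forall s, C2Derive g0 s
    = ((e * fst (C2Derive g (s0 + e * s)))%C, (e * snd (C2Derive g (s0 + e * s)))%C)).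
  { intros s; unfold C2Derive; simpl.
    rewrite <- !CDerive_affine by assumption.
    f_equal; unfold CDerive; f_equal; apply Derive_ext; intros t; now rewrite E. }
  split.
  - split; [ apply (ext (fun s => fst (g (s0 + e * s)))), (rsm _ S1)
           | apply (ext (fun s => snd (g (s0 + e * s)))), (rsm _ S2) ];
      intros s; now rewrite E.
  - intros s; rewrite D, E.
    destruct (U (s0 + e * s)) as [U1 [U2 U3]].
    revert U1 U2 U3; generalize (C2Derive g (s0 + e * s)) (g (s0 + e * s)).
    intros [v w] [x y]; unfold herm; simpl; intros U1 U2 U3.
    split; [ exact U1 | split ].
    + transitivity (e * (v * Cconj x + w * Cconj y))%C; [ ring | rewrite U2; ring ].
    + assert (Hc : Cconj e = e) by (apply injective_projections; simpl; ring).
      assert (HeC : (e * e = 1)%C) by (rewrite <- RtoC_mult, He; reflexivity).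
      rewrite !Cmult_conj, Hc.
      transitivity (e * e * (v * Cconj v + w * Cconj w))%C; [ ring |].
      rewrite U3, HeC; ring.
Qed.

Lemma periodic_affine (g g0 : R -> C2) (s0 e : R) :
  e * e = 1 -> (forall s, g0 s = g (s0 + e * s)) -> (periodic g <-> periodic g0).
Proof.
  intros He E.
  assert (Ee : e = 1 \/ e = -1).
  { assert (H : (e - 1) * (e + 1) = 0) by lra.
    apply Rmult_integral in H; lra. }
  split; intros [w [Hw H]]; exists w; split; trivial; intros s.
  - rewrite !E; destruct Ee as [-> | ->].
    + rewrite <- (H (s0 + 1 * s)); f_equal; ring.
    + rewrite <- (H (s0 + -1 * (s + w))); f_equal; ring.
  - assert (I : forall t, g t = g0 (e * (t - s0))).
    { intros t; rewrite E; f_equal.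
      transitivity (s0 + (e * e) * (t - s0)); [ rewrite He |]; ring. }
    rewrite !I; destruct Ee as [-> | ->].
    + rewrite <- (H (1 * (s - s0))); f_equal; ring.
    + rewrite <- (H (-1 * (s + w - s0))); f_equal; ring.
Qed.

Lemma periodic_Derive (f : R -> R) (T : R) :
  (forall s, f (s + T) = f s) -> forall s, Derive f (s + T) = Derive f s.
Proof.
  intros H s.
  rewrite <- (Derive_ext (fun t => f (t + T)) f s H).
  symmetry; exact (Derive_n_comp_trans f 1 s T).
Qed.

Lemma period_C2Derive (g : R -> C2) (T : R) :
  period g T -> period (C2Derive g) T.
Proof.
  intros [H0 H]; split; trivial; intros s.
  apply injective_projections; apply injective_projections; simpl;
  [ apply (periodic_Derive (fun t => Re (fst (g t))))
  | apply (periodic_Derive (fun t => Im (fst (g t))))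
  | apply (periodic_Derive (fun t => Re (snd (g t))))
  | apply (periodic_Derive (fun t => Im (snd (g t)))) ];
  intros t; now rewrite H.
Qed.

Lemma period_curvature (g : R -> C2) (T : R) :
  period g T -> period (curvature g) T.
Proof.
  intros H; pose proof (period_C2Derive _ _ H) as H1.
  pose proof (period_C2Derive _ _ H1) as H2.
  split; [ apply H | intros s; unfold curvature ].
  now rewrite (proj2 H1), (proj2 H2).
Qed.

(** The linear equation [u'' = i k u' - u], with [u1] the derivative of [u];
    both coordinates of a unit-speed Legendrian curve of curvature [k] solve
    it. *)
Definition solution (k : R -> R) (u u1 : R -> C) : Prop :=
  forall s, is_cderive u s (u1 s) /\ is_cderive u1 s (Ci * k s * u1 s - u s)%C.

Definition wronskian (x x1 y y1 : R -> C) (s : R) : C := (x s * y1 s - y s * x1 s)%C.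

(** The unitary frame formed by the curve [(x, y)] and its velocity
    [(x1, y1)].  In dimension two a unit vector determines its orthogonal
    complement up to a phase, which is the wronskian: hence [frame_x1E] and
    [frame_y1E]. *)
Record moving_frame (k : R -> R) (x x1 y y1 : R -> C) : Prop := {
  frame_x : solution k x x1;
  frame_y : solution k y y1;
  frame_unit : forall s, (x s * Cconj (x s) + y s * Cconj (y s) = 1)%C;
  frame_wronskian_unit : forall s,
    (wronskian x x1 y y1 s * Cconj (wronskian x x1 y y1 s) = 1)%C;
  frame_x1E : forall s, x1 s = (- (wronskian x x1 y y1 s * Cconj (y s)))%C;
  frame_y1E : forall s, y1 s = (wronskian x x1 y y1 s * Cconj (x s))%C
}.

Lemma rsmooth_curvature (g : R -> C2) : smooth2 g -> rsmooth (curvature g).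
Proof.
  intros [S1 S2].
  pose proof (fun n s => proj1 (S1 n s) : ex_derive_n _ n s) as A.
  pose proof (fun n s => proj2 (S1 n s) : ex_derive_n _ n s) as B.
  pose proof (fun n s => proj1 (S2 n s) : ex_derive_n _ n s) as A'.
  pose proof (fun n s => proj2 (S2 n s) : ex_derive_n _ n s) as B'.
  change (rsmooth (fun s => Re (fst (g s)))) in A.
  change (rsmooth (fun s => Im (fst (g s)))) in B.
  change (rsmooth (fun s => Re (snd (g s)))) in A'.
  change (rsmooth (fun s => Im (snd (g s)))) in B'.
  unfold curvature, herm, C2Derive, CDerive, Cconj, Cplus, Cmult; simpl.
  repeat match goal with
  | |- rsmooth (fun s => _ + _) => apply rsmooth_plus
  | |- rsmooth (fun s => _ - _) => apply rsmooth_minus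
  | |- rsmooth (fun s => _ * _) => apply rsmooth_mult
  | |- rsmooth (fun s => - _) => apply rsmooth_opp
  | |- rsmooth (fun s => Derive _ s) => apply rsmooth_Derive
  | |- rsmooth (Derive _) => apply rsmooth_Derive
  | |- _ => assumption
  end.
Qed.

(** The frame [(g, g')] is unitary, so [g''] is determined by its products with
    [g] and [g'].  Differentiating the Legendrian condition gives [-1] for the
    first; differentiating the unit speed shows that the second is imaginary,
    hence equal to [i k]. *)
Lemma legendrian_frame (g : R -> C2) :
  unit_speed_legendrian g ->
  moving_frame (curvature g)
    (fun s => fst (g s)) (fun s => fst (C2Derive g s))
    (fun s => snd (g s)) (fun s => snd (C2Derive g s)).
Proof.
  intros [[S1 S2] U].
  assert (D1 : forall f : R -> C, smooth f -> forall s, is_cderive f s (CDerive f s)).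
  { intros f Hf s; apply is_cderive_CDerive; apply (Hf 1%nat s). }
  assert (D2 : forall f : R -> C, smooth f ->
                 forall s, is_cderive (CDerive f) s (CDerive (CDerive f) s)).
  { intros f Hf s; apply is_cderive_CDerive; apply (Hf 2%nat s). }
  set (x := fun s => fst (g s)) in *; set (y := fun s => snd (g s)) in *.
  change (fun s => fst (C2Derive g s)) with (CDerive x).
  change (fun s => snd (C2Derive g s)) with (CDerive y).
  assert (kE : forall s, curvature g s =
     Im (CDerive (CDerive x) s * Cconj (CDerive x s)
         + CDerive (CDerive y) s * Cconj (CDerive y s))%C) by reflexivity.
  assert (U1 : forall s, (x s * Cconj (x s) + y s * Cconj (y s) = 1)%C)
    by (intros s; apply U).
  assert (U2 : forall s, (CDerive x s * Cconj (x s) + CDerive y s * Cconj (y s) = 0)%C)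
    by (intros s; apply U).
  assert (U3 : forall s, (CDerive x s * Cconj (CDerive x s)
                          + CDerive y s * Cconj (CDerive y s) = 1)%C)
    by (intros s; apply U).
  pose proof (D1 x S1) as dx; pose proof (D1 y S2) as dy.
  pose proof (D2 x S1) as dx1; pose proof (D2 y S2) as dy1.
  clear U S1 S2 D1 D2.
  generalize dependent (curvature g); intros k kE.
  revert kE U1 U2 U3 dx dy dx1 dy1.
  generalize (CDerive (CDerive x)) (CDerive (CDerive y)).
  generalize (CDerive x) (CDerive y); clearbody x y; clear g.
  intros x1 y1 x2 y2 kE U1 U2 U3 dx dy dx1 dy1.
  assert (V2 : forall s, (x2 s * Cconj (x s) + y2 s * Cconj (y s) = - RtoC 1)%C).
  { intros s.
    pose proof (is_cderive_plus _ _ _ _ _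
      (is_cderive_mult _ _ _ _ _ (dx1 s) (is_cderive_conj _ _ _ (dx s)))
      (is_cderive_mult _ _ _ _ _ (dy1 s) (is_cderive_conj _ _ _ (dy s)))) as H.
    apply (is_cderive_ext _ (fun _ => 0%C) s _ U2) in H.
    pose proof (is_cderive_unique _ _ _ _ H (is_cderive_const 0%C s)) as E.
    rewrite <- (U3 s).
    transitivity ((x2 s * Cconj (x s) + x1 s * Cconj (x1 s)
                   + (y2 s * Cconj (y s) + y1 s * Cconj (y1 s)))
                  - (x1 s * Cconj (x1 s) + y1 s * Cconj (y1 s)))%C; [ ring |].
    rewrite E; ring. }
  assert (V3 : forall s, (x2 s * Cconj (x1 s) + y2 s * Cconj (y1 s) = Ci * k s)%C).
  { intros s.
    pose proof (is_cderive_plus _ _ _ _ _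
      (is_cderive_mult _ _ _ _ _ (dx1 s) (is_cderive_conj _ _ _ (dx1 s)))
      (is_cderive_mult _ _ _ _ _ (dy1 s) (is_cderive_conj _ _ _ (dy1 s)))) as H.
    apply (is_cderive_ext _ (fun _ => 1%C) s _ U3) in H.
    pose proof (is_cderive_unique _ _ _ _ H (is_cderive_const 1%C s)) as E.
    rewrite kE; cbv beta in E; revert E; generalize (x2 s) (y2 s) (x1 s) (y1 s).
    intros [p p'] [q q'] [u u'] [v v'] E; apply (f_equal Re) in E.
    unfold Re, Im in *; simpl in E.
    apply injective_projections; simpl; lra. }
  set (d := wronskian x x1 y y1).
  assert (X1 : forall s, x1 s = (- (d s * Cconj (y s)))%C).
  { intros s; unfold d, wronskian.
    transitivity (x1 s * (x s * Cconj (x s) + y s * Cconj (y s))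
       - x s * (x1 s * Cconj (x s) + y1 s * Cconj (y s)))%C;
      [ rewrite U1, U2 |]; ring. }
  assert (Y1 : forall s, y1 s = (d s * Cconj (x s))%C).
  { intros s; unfold d, wronskian.
    transitivity (y1 s * (x s * Cconj (x s) + y s * Cconj (y s))
       - y s * (x1 s * Cconj (x s) + y1 s * Cconj (y s)))%C;
      [ rewrite U1, U2 |]; ring. }
  assert (DD : forall s, (d s * Cconj (d s) = 1)%C).
  { intros s; rewrite <- (U3 s), X1, Y1.
    rewrite Copp_conj, !Cmult_conj, !Cconj_conj.
    transitivity (d s * Cconj (d s) * (x s * Cconj (x s) + y s * Cconj (y s)))%C;
      [ rewrite U1 |]; ring. }
  assert (X2 : forall s, x2 s = (Ci * k s * x1 s - x s)%C).
  { intros s; rewrite <- (V3 s).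
    transitivity (x2 s * (x s * Cconj (x s) + Cconj (y s) * y s * (d s * Cconj (d s))))%C.
    { rewrite DD; transitivity (x2 s * (x s * Cconj (x s) + y s * Cconj (y s)))%C;
        [ rewrite U1 |]; ring. }
    transitivity (x s * (x2 s * Cconj (x s) + y2 s * Cconj (y s))
      + x1 s * (x2 s * Cconj (x1 s) + y2 s * Cconj (y1 s)))%C; [| rewrite V2; ring ].
    rewrite X1, Y1, Copp_conj, !Cmult_conj, !Cconj_conj.
    transitivity (x2 s * (x s * Cconj (x s) + Cconj (y s) * y s * (d s * Cconj (d s)))
      + y2 s * x s * Cconj (y s) * (1 - d s * Cconj (d s)))%C;
      [ rewrite DD |]; ring. }
  assert (Y2 : forall s, y2 s = (Ci * k s * y1 s - y s)%C).
  { intros s; rewrite <- (V3 s).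
    transitivity (y2 s * (y s * Cconj (y s) + Cconj (x s) * x s * (d s * Cconj (d s))))%C.
    { rewrite DD; transitivity (y2 s * (x s * Cconj (x s) + y s * Cconj (y s)))%C;
        [ rewrite U1 |]; ring. }
    transitivity (y s * (x2 s * Cconj (x s) + y2 s * Cconj (y s))
      + y1 s * (x2 s * Cconj (x1 s) + y2 s * Cconj (y1 s)))%C; [| rewrite V2; ring ].
    rewrite X1, Y1, Copp_conj, !Cmult_conj, !Cconj_conj.
    transitivity (y2 s * (y s * Cconj (y s) + Cconj (x s) * x s * (d s * Cconj (d s)))
      + x2 s * y s * Cconj (x s) * (1 - d s * Cconj (d s)))%C;
      [ rewrite DD |]; ring. }
  split; trivial; intros s; split; trivial; [ rewrite <- X2 | rewrite <- Y2 ]; trivial.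
Qed.

(** * The curvature equation *)

(** The divided differences of [P] at [e1, e2, e3] give [a] and [b], and
    therefore the factorization of [P], whose roots are visibly distinct. *)
Lemma dnoidal_simple_roots (a b c e1 e2 e3 x : R) :
  dnoidal a b c e1 e2 e3 -> P a b c x = 0 -> x ^ 3 + 2 * a * x + b <> 0.
Proof.
  intros [H12 [H23 [H34 [E1 [E2 [E3 E4]]]]]] Hx; unfold P in *.
  set (e4 := - (e1 + e2 + e3)) in *.
  assert (Ha : a = - / 4 * (e1 ^ 2 + e2 ^ 2 + e3 ^ 2 + e1 * e2 + e1 * e3 + e2 * e3)).
  { apply (Rmult_eq_reg_l ((e1 - e2) * (e1 - e3) * (e2 - e3)));
      [| repeat apply Rmult_integral_contrapositive_currified; lra ].
    assert (D12 : (e1 - e2) * (/ 4 * (e1 ^ 3 + e1 ^ 2 * e2 + e1 * e2 ^ 2 + e2 ^ 3)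
       + a * (e1 + e2) + b) = 0) by lra.
    assert (D13 : (e1 - e3) * (/ 4 * (e1 ^ 3 + e1 ^ 2 * e3 + e1 * e3 ^ 2 + e3 ^ 3)
       + a * (e1 + e3) + b) = 0) by lra.
    apply Rmult_integral in D12; destruct D12 as [D12 | D12]; [ lra |].
    apply Rmult_integral in D13; destruct D13 as [D13 | D13]; [ lra |].
    apply Rminus_diag_uniq.
    transitivity ((e1 - e2) * (e1 - e3) *
      ((/ 4 * (e1 ^ 3 + e1 ^ 2 * e2 + e1 * e2 ^ 2 + e2 ^ 3) + a * (e1 + e2) + b)
       - (/ 4 * (e1 ^ 3 + e1 ^ 2 * e3 + e1 * e3 ^ 2 + e3 ^ 3) + a * (e1 + e3) + b)));
      [| rewrite D12, D13 ]; field. }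
  assert (Hb : b = - (/ 4 * (e1 ^ 3 + e1 ^ 2 * e2 + e1 * e2 ^ 2 + e2 ^ 3)
       + a * (e1 + e2))).
  { apply (Rmult_eq_reg_l (e1 - e2)); lra. }
  assert (F : forall z, / 4 * z ^ 4 + a * z ^ 2 + b * z + c
            = / 4 * ((z - e1) * (z - e2) * (z - e3) * (z - e4))).
  { intros z; replace c with (- (/ 4 * e1 ^ 4 + a * e1 ^ 2 + b * e1)) by lra.
    rewrite Hb, Ha; unfold e4; field. }
  assert (F' : forall z, z ^ 3 + 2 * a * z + b
            = / 4 * ((z - e2) * (z - e3) * (z - e4) + (z - e1) * (z - e3) * (z - e4)
                   + (z - e1) * (z - e2) * (z - e4) + (z - e1) * (z - e2) * (z - e3))).
  { intros z; rewrite Hb, Ha; unfold e4; field. }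
  rewrite F in Hx; rewrite F'.
  assert (R : x = e1 \/ x = e2 \/ x = e3 \/ x = e4).
  { apply Rmult_integral in Hx; destruct Hx as [Hx | Hx]; [ lra |].
    repeat (apply Rmult_integral in Hx; destruct Hx as [Hx | Hx]); lra. }
  clearbody e4; clear - H12 H23 H34 R; intros Z.
  destruct R as [-> | [-> | [-> | ->]]];
  [ assert (Y : (e1 - e2) * (e1 - e3) * (e1 - e4) = 0) by lra
  | assert (Y : (e2 - e1) * (e2 - e3) * (e2 - e4) = 0) by lra
  | assert (Y : (e3 - e1) * (e3 - e2) * (e3 - e4) = 0) by lra
  | assert (Y : (e4 - e1) * (e4 - e2) * (e4 - e3) = 0) by lra ];
  repeat (apply Rmult_integral in Y; destruct Y as [Y | Y]); lra.
Qed.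

(** The difference between [P] and the monic quartic over [4] with the four
    given roots has degree at most two and four distinct roots, so it
    vanishes. *)
Lemma cnoidal_simple_roots (a b c e1 e2 e3 x : R) :
  cnoidal a b c e1 e2 e3 -> P a b c x = 0 -> x ^ 3 + 2 * a * x + b <> 0.
Proof.
  intros [H12 [H3 [R [Z _]]]] Hx.
  assert (E1 : P a b c e1 = 0) by (apply R; now left).
  assert (E2 : P a b c e2 = 0) by (apply R; now right).
  apply R in Hx; clear R; unfold P in E1, E2.
  (* [a0], [b0], [c0] are the coefficients of the quartic with these roots. *)
  pose (m := - / 2 * (e1 + e2)).
  pose (a0 := / 4 * (m ^ 2 + e3 ^ 2 + e1 * e2 - 4 * m ^ 2)).
  assert (Zr := f_equal Re Z); assert (Zi := f_equal Im Z).
  unfold PC, Re, Im in Zr, Zi; simpl in Zr, Zi; fold m in Zr, Zi.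
  clear Z.
  pose (b0 := / 4 * (- 2 * m * e1 * e2 + 2 * m * (m ^ 2 + e3 ^ 2))).
  pose (c0 := / 4 * (e1 * e2 * (m ^ 2 + e3 ^ 2))).
  assert (I1 : (a - a0) * e1 ^ 2 + (b - b0) * e1 + (c - c0) = 0).
  { rewrite <- E1; unfold a0, b0, c0, m; field. }
  assert (I2 : (a - a0) * e2 ^ 2 + (b - b0) * e2 + (c - c0) = 0).
  { rewrite <- E2; unfold a0, b0, c0, m; field. }
  assert (I3 : (a - a0) * (m ^ 2 - e3 ^ 2) + (b - b0) * m + (c - c0) = 0).
  { rewrite <- Zr; unfold a0, b0, c0, m; field. }
  assert (I4 : (2 * (a - a0) * m + (b - b0)) * e3 = 0).
  { rewrite <- Zi; unfold a0, b0, c0, m; field. }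
  clear Zr Zi.
  apply Rmult_integral in I4; destruct I4 as [I4 | I4]; [| lra ].
  assert (I5 : (a - a0) * (e1 + e2) + (b - b0) = 0).
  { apply (Rmult_eq_reg_l (e1 - e2)); lra. }
  assert (A : a - a0 = 0).
  { destruct (Req_dec (a - a0) 0) as [A | A]; [ exact A | exfalso ].
    assert (Hm : m = 0).
    { apply (Rmult_eq_reg_l (a - a0)); [| exact A ].
      unfold m in *; lra. }
    assert (B : b - b0 = 0) by (rewrite Hm in I4; lra).
    rewrite Hm, B in I3; rewrite B in I1.
    assert (X : (a - a0) * (e1 ^ 2 + e3 ^ 2) = 0) by lra.
    apply Rmult_integral in X; nra. }
  assert (B : b - b0 = 0) by (rewrite A in I4; lra).
  assert (F' : forall z, z ^ 3 + 2 * a * z + b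
    = / 4 * ((2 * z - (e1 + e2)) * ((z - m) ^ 2 + e3 ^ 2)
             + (z - e1) * (z - e2) * (2 * (z - m)))).
  { intros z; replace a with a0 by lra; replace b with b0 by lra.
    unfold a0, b0, m; field. }
  rewrite F'; intros Y.
  destruct Hx as [-> | ->].
  - assert (W : (e1 - e2) * ((e1 - m) ^ 2 + e3 ^ 2) = 0) by lra.
    apply Rmult_integral in W; pose proof (pow2_ge_0 (e1 - m)); nra.
  - assert (W : (e1 - e2) * ((e2 - m) ^ 2 + e3 ^ 2) = 0) by lra.
    apply Rmult_integral in W; pose proof (pow2_ge_0 (e2 - m)); nra.
Qed.

Record quartic_flow (a b c : R) (k k1 : R -> R) : Prop := {
  flow_k : forall s, is_derive k s (k1 s);
  flow_k1 : forall s, is_derive k1 s (- (/ 2 * (k s ^ 3 + 2 * a * k s + b)));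
  flow_energy : forall s, k1 s ^ 2 + P a b c (k s) = 0
}.

(** Write the linear equation as [F' = A F] for [F = (u, u')].  The curvature
    equation says that the matrix [i (k' s1 + lax2 s2 + lax3 s3)], with Pauli
    matrices [s1, s2, s3], evolves by commutators with the traceless part of
    [A]; so its eigenvalues are constant, and they are [i lambda] and
    [- i lambda]. *)
Definition lax2 (a k : R) : R := / 2 * k ^ 2 + a - 4.
Definition lax3 (b k : R) : R := 2 * k + / 4 * b.

Lemma lambda_sqr (a b c k k1 : R) :
  k1 ^ 2 + P a b c k = 0 ->
  lambda a b c ^ 2 = k1 ^ 2 + lax2 a k ^ 2 + lax3 b k ^ 2.
Proof.
  intros E; unfold lambda.
  assert (X : 256 - 128 * a + 16 * a ^ 2 + b ^ 2 - 16 * c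
            = 16 * (k1 ^ 2 + lax2 a k ^ 2 + lax3 b k ^ 2)).
  { unfold lax2, lax3, P in *.
    replace (k1 ^ 2) with (- (/ 4 * k ^ 4 + a * k ^ 2 + b * k + c)) by lra; field. }
  rewrite Rpow_mult_distr, pow2_sqrt, X; [ field |].
  rewrite X; nra.
Qed.

(** A second point near [s] with the value [f s] would give, by the mean value theorem, a critical
    point arbitrarily close to the nondegenerate one [s]. *)
Lemma isolated_critical_point (f f1 : R -> R) (s l : R) :
  (forall t, is_derive f t (f1 t)) -> is_derive f1 s l -> f1 s = 0 -> l <> 0 ->
  locally' s (fun t => f t <> f s).
Proof.
  intros H H1 Z L.
  destruct (proj1 (is_derive_Reals f1 s l) H1 (Rabs l) (Rabs_pos_lt _ L)) as [d Hd].
  exists d; intros t Ht Hts E.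
  assert (N : forall x, Rabs (x - s) < d -> x <> s -> f1 x <> 0).
  { intros x Hx Hxs F; specialize (Hd (x - s)).
    replace (s + (x - s)) with x in Hd by ring.
    rewrite F, Z in Hd.
    replace ((0 - 0) / (x - s) - l) with (- l) in Hd by (field; lra).
    rewrite Rabs_Ropp in Hd.
    apply (Rlt_irrefl (Rabs l)), Hd; [ lra | exact Hx ]. }
  assert (D : forall x, derivable_pt_lim f x (f1 x)) by (intros x; now apply is_derive_Reals).
  change (Rabs (t - s) < d) in Ht; apply Rabs_def2 in Ht.
  destruct (Rtotal_order s t) as [Lt | [-> | Lt]]; [| easy |].
  - destruct (MVT_cor2 f f1 s t Lt) as [x [M Hx]]; [ intros; apply D |].
    apply (N x); [ apply Rabs_def1 |  |]; try lra.
    apply (Rmult_eq_reg_r (t - s)); lra.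
  - destruct (MVT_cor2 f f1 t s Lt) as [x [M Hx]]; [ intros; apply D |].
    apply (N x); [ apply Rabs_def1 |  |]; try lra.
    apply (Rmult_eq_reg_r (s - t)); lra.
Qed.

(** [mu] is the rate at which the phase of the solution
    [sqrt (lax3 + lambda) * exp (i * integral of mu)] turns.  Where
    [lax3 + lambda] does not vanish, [rate_x2] defines [mu] and, with
    [lambda_sqr], implies [rate_k1]; at its zeros [rate_k1] is what remains to be required for the
    symmetric square of that solution to extend across them. *)
Record phase_rate (a b c : R) (k k1 mu mu1 : R -> R) : Prop := {
  rate_derive : forall s, is_derive mu s (mu1 s);
  rate_x2 : forall s, mu s * (lax3 b (k s) + lambda a b c) = lax2 a (k s);
  rate_k1 : forall s,
    mu1 s * k1 s = (lambda a b c - lax3 b (k s) - mu s * lax2 a (k s)) * (k s - 2 * mu s)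
}.

Lemma Lambda_den_E (a b c : R) (k : R -> R) (s : R) :
  Lambda_den a b c k s = 16 * (lax3 b (k s) + lambda a b c).
Proof. unfold Lambda_den, lax3; field. Qed.

(** [Lambda] is the rate [mu], up to sign and the share [k / 4] of the trace. *)
Lemma Lambda_quot_regular (a b c : R) (k : R -> R) (s mu : R) :
  lax3 b (k s) + lambda a b c <> 0 ->
  mu * (lax3 b (k s) + lambda a b c) = lax2 a (k s) ->
  Lambda_quot a b c k s = / 4 * k s - mu.
Proof.
  intros N H; unfold Lambda_quot; rewrite Lambda_den_E.
  apply (Rmult_eq_reg_r (16 * (lax3 b (k s) + lambda a b c))); [| lra ].
  unfold Rdiv; rewrite Rmult_assoc, Rinv_l by lra.
  unfold lax2, lax3 in *; lra.
Qed.

(** If [lax3 + lambda] vanishes at [s0], then [k'] and [lax2] vanish there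
    too, because the squares of the three components add up to [lambda^2].
    This fixes [a] and [lambda] in terms of [k s0], and [lax3 + lambda] then
    divides [lax2] as a polynomial in [k]: the rate is [(k + k s0) / 4] and
    [Lambda] is the constant [- k s0 / 4].  At the zeros of the denominator the
    value of [Lambda] is a punctured limit, so the zeros must be isolated; this
    is where the roots of [P] have to be simple. *)
Lemma exists_phase_rate (a b c e1 e2 e3 : R) (k k1 : R -> R) :
  quartic_flow a b c k k1 ->
  dnoidal a b c e1 e2 e3 \/ cnoidal a b c e1 e2 e3 ->
  exists F mu1, let mu := fun s => F (k s) in
    phase_rate a b c k k1 mu mu1 /\
    forall s, Lambda a b c k s = / 4 * k s - mu s.
Proof.
  intros [Hk Hk1 E] Hroots.
  pose proof (fun s => lambda_sqr a b c (k s) (k1 s) (E s)) as L2.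
  set (lam := lambda a b c) in *.
  destruct (classic (exists s, lax3 b (k s) + lam = 0)) as [[s0 H0] | H0].
  - assert (A1 : k1 s0 = 0).
    { specialize (L2 s0); replace lam with (- lax3 b (k s0)) in L2 by lra.
      pose proof (pow2_ge_0 (k1 s0)); pose proof (pow2_ge_0 (lax2 a (k s0))); nra. }
    assert (A2 : lax2 a (k s0) = 0).
    { specialize (L2 s0); replace lam with (- lax3 b (k s0)) in L2 by lra.
      pose proof (pow2_ge_0 (k1 s0)); pose proof (pow2_ge_0 (lax2 a (k s0))); nra. }
    assert (Lm : lam = - (2 * k s0 + / 4 * b)) by (unfold lax3 in H0; lra).
    assert (Am : a = 4 - / 2 * k s0 ^ 2) by (unfold lax2 in A2; lra).
    assert (X2 : forall s, / 4 * (k s + k s0) * (lax3 b (k s) + lam) = lax2 a (k s)).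
    { intros s; unfold lax2, lax3; rewrite Lm, Am; field. }
    exists (fun x => / 4 * (x + k s0)), (fun s => / 4 * k1 s); simpl; split.
    + split.
      * intros s; apply (is_derive_eq _ _ (scal (/ 4) (k1 s))); [| reflexivity ].
        apply (is_derive_scal (fun t => k t + k s0)).
        apply (is_derive_eq _ _ (plus (k1 s) 0)); [| unfold plus; simpl; ring ].
        apply (is_derive_plus k (fun _ => k s0)); [ apply Hk | exact (is_derive_const _ _) ].
      * exact X2.
      * intros s; specialize (L2 s); specialize (X2 s); fold lam.
        transitivity (/ 4 * (lam ^ 2 - lax2 a (k s) ^ 2 - lax3 b (k s) ^ 2)); [ lra |].
        transitivity (/ 4 * (lax3 b (k s) + lam) *
          (lam - lax3 b (k s) - / 4 * (k s + k s0) * lax2 a (k s))); [ rewrite <- X2 at 1; ring_simplify; nra |].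
        unfold lax3; rewrite Lm; field.
    + assert (Q : forall s, lax3 b (k s) + lam <> 0 ->
                Lambda_quot a b c k s = - / 4 * k s0).
      { intros s N; rewrite (Lambda_quot_regular a b c k s _ N (X2 s)); field. }
      intros s; unfold Lambda; destruct Req_EM_T as [D | D];
        rewrite Lambda_den_E in D; fold lam in D.
      * assert (Ks : k s = k s0) by (unfold lax3 in *; lra).
        assert (N : locally' s (fun t => k t <> k s)).
        { apply (isolated_critical_point k k1 s _ Hk (Hk1 s)).
          - pose proof (E s) as Es; rewrite Ks in Es; rewrite <- (E s0), A1 in Es.
            apply Rsqr_0_uniq; unfold Rsqr; lra.
          - rewrite Ks; intros Z.
            assert (Z' : k s0 ^ 3 + 2 * a * k s0 + b = 0) by lra.
            assert (Pz : P a b c (k s0) = 0) by (rewrite <- (E s0), A1; ring).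
            destruct Hroots as [Hr | Hr];
              [ apply (dnoidal_simple_roots _ _ _ _ _ _ _ Hr Pz Z')
              | apply (cnoidal_simple_roots _ _ _ _ _ _ _ Hr Pz Z') ]. }
        rewrite (is_lim_unique _ s (- / 4 * k s0)).
        -- simpl; rewrite Ks; field.
        -- apply (is_lim_ext_loc (fun _ => - / 4 * k s0)); [| apply is_lim_const ].
           revert N; apply filter_imp; intros t Ht; symmetry; apply Q.
           unfold lax3 in *; lra.
      * rewrite Q by lra; field.
  - assert (N : forall s, lax3 b (k s) + lam <> 0) by (intros s Z; apply H0; now exists s).
    set (F := fun x => lax2 a x / (lax3 b x + lam)).
    assert (FE : forall s, F (k s) * (lax3 b (k s) + lam) = lax2 a (k s))
      by (intros s; unfold F; field; apply N).
    exists F, (fun s => k1 s * ((k s - 2 * F (k s)) / (lax3 b (k s) + lam))).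
    simpl; split; [ split |].
    + intros s; apply (is_derive_comp F k); [| apply Hk ].
      specialize (N s); unfold F, lax2, lax3 in *; auto_derive; [ exact N |].
      field; lra.
    + exact FE.
    + intros s; specialize (N s); specialize (L2 s); specialize (FE s); fold lam.
      apply (Rmult_eq_reg_r (lax3 b (k s) + lam)); [| exact N ].
      transitivity (k1 s ^ 2 * (k s - 2 * F (k s))); [ field; exact N |].
      replace (k1 s ^ 2) with (lam ^ 2 - lax3 b (k s) ^ 2 - lax2 a (k s) ^ 2) by lra.
      rewrite <- FE; ring.
    + intros s; unfold Lambda; destruct Req_EM_T as [D | D].
      * rewrite Lambda_den_E in D; fold lam in D; specialize (N s); lra.
      * apply Lambda_quot_regular; [ apply N | apply FE ].
Qed.

(** * Primitives *)

Definition integral0 (f : R -> R) (s : R) : R := RInt f 0 s.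

Lemma integral0_derive (f : R -> R) :
  (forall s, continuous f s) -> forall s, is_derive (integral0 f) s (f s).
Proof.
  intros H s; apply (is_derive_RInt f (integral0 f) 0 s); [| apply H ].
  apply filter_forall; intros t;
  apply (RInt_correct f 0 t), (ex_RInt_continuous (V := R_CompleteNormedModule)); auto.
Qed.

Lemma integral0_0 (f : R -> R) : integral0 f 0 = 0.
Proof. exact (RInt_point 0 f). Qed.

Lemma integral0_shift (f : R -> R) (T : R) :
  (forall s, continuous f s) -> (forall s, f (s + T) = f s) ->
  forall s, integral0 f (s + T) = integral0 f s + integral0 f T.
Proof.
  intros Hc HT s.
  assert (D : forall t, is_derive (fun t => integral0 f (t + T) - integral0 f t) t 0).
  { intros t; apply (is_derive_eq _ _ (minus (f (t + T)) (f t))).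
    - apply (is_derive_minus (fun t => integral0 f (t + T)) (integral0 f)).
      + apply is_derive_shift, integral0_derive, Hc.
      + apply integral0_derive, Hc.
    - rewrite HT; unfold minus, plus, opp; simpl; ring. }
  pose proof (derive_0_constant _ D s 0) as E; simpl in E.
  rewrite integral0_0, Rplus_0_l in E; lra.
Qed.

Lemma shift_INR {A : Type} (f : R -> A) (T : R) :
  (forall s, f (s + T) = f s) -> forall n s, f (s + INR n * T) = f s.
Proof.
  intros H n; induction n as [| n IH]; intros s.
  - f_equal; simpl; ring.
  - rewrite S_INR, <- (IH s), <- (H (s + INR n * T)); f_equal; ring.
Qed.

Lemma integral0_INR (f : R -> R) (T : R) :
  (forall s, continuous f s) -> (forall s, f (s + T) = f s) ->
  forall n, integral0 f (INR n * T) = INR n * integral0 f T.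
Proof.
  intros Hc HT n; induction n as [| n IH].
  - simpl; rewrite !Rmult_0_l; apply integral0_0.
  - rewrite S_INR, Rmult_plus_distr_r, Rmult_1_l, integral0_shift, IH by trivial; ring.
Qed.

(** * The symmetric square *)

(** The squared norm of [(u, u')] is conserved. *)
Lemma solution_unique (k : R -> R) (u u1 : R -> C) (s0 : R) :
  solution k u u1 -> u s0 = 0%C -> u1 s0 = 0%C -> forall s, u s = 0%C.
Proof.
  intros H Z Z1 s.
  pose (N := fun t => (u t * Cconj (u t) + u1 t * Cconj (u1 t))%C).
  assert (D : forall t, is_cderive N t 0%C).
  { intros t; destruct (H t) as [Hu Hu1].
    eapply is_cderive_eq;
      [ apply is_cderive_plus; apply is_cderive_mult;
        [ exact Hu | apply is_cderive_conj, Hu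
        | exact Hu1 | apply is_cderive_conj, Hu1 ] |].
    cbv beta; generalize (k t) (u t) (u1 t); intros h [v v'] [w w'].
    apply injective_projections; simpl; ring. }
  assert (E : N s = 0%C).
  { rewrite (cderive_0_constant N D s s0); unfold N; rewrite Z, Z1; ring. }
  apply (f_equal fst) in E; unfold N in E; revert E.
  generalize (u s) (u1 s); intros [v v'] [w w']; simpl; intros E.
  pose proof (pow2_ge_0 v); pose proof (pow2_ge_0 v').
  pose proof (pow2_ge_0 w); pose proof (pow2_ge_0 w').
  apply injective_projections; simpl; nra.
Qed.

(** For the eigenvalue [i lambda], [(weight_p, Cconj weight_q)] is an
    eigenvector of the matrix above, and the solution of the linear equation is
    this vector divided by [sqrt weight_p], times the phase.  The division
    fails at zeros of [weight_p], where the square root also has to change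
    branch.  The tensor square of the solution has neither defect: its
    coordinates are [weight_p], [Cconj weight_q] and
    [(Cconj weight_q)^2 / weight_p = Cconj weight_r], times the squared
    phase. *)
Definition weight_p (b lam k : R) : C := RtoC (lax3 b k + lam).
Definition weight_q (a k k1 : R) : C := (k1, - lax2 a k).
Definition weight_r (a b lam k k1 mu : R) : C :=
  (lam - lax3 b k - 2 * mu * lax2 a k, - (2 * mu * k1)).

(** The linear system satisfied by the conjugate tensor square of the special
    solution once its squared phase has been split off.  It is dual to the
    system satisfied by [u v], [u v1 + u1 v], [u1 v1] for solutions
    [u], [v]. *)
Record weights (k mu : R -> R) (p q r : R -> C) : Prop := {
  weights_p : forall s, is_cderive p s (q s + q s + Ci * mu s * (p s + p s))%C;
  weights_q : forall s,
    is_cderive q s (r s - Ci * k s * q s - p s + Ci * mu s * (q s + q s))%C;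
  weights_r : forall s,
    is_cderive r s (- (Ci * k s * (r s + r s)) - (q s + q s) + Ci * mu s * (r s + r s))%C;
  weights_square : forall s, (p s * r s = q s * q s)%C
}.

(** Undoes the eta-expansions which [auto_derive] leaves under [Derive]. *)
Ltac eta_Derive :=
  repeat match goal with
  | |- context [Derive (fun x => ?f x) ?s] =>
      progress change (Derive (fun x => f x) s) with (Derive f s)
  end.

Lemma flow_weights (a b c : R) (k k1 mu mu1 : R -> R) :
  quartic_flow a b c k k1 -> phase_rate a b c k k1 mu mu1 ->
  weights k mu
    (fun s => weight_p b (lambda a b c) (k s))
    (fun s => weight_q a (k s) (k1 s))
    (fun s => weight_r a b (lambda a b c) (k s) (k1 s) (mu s)).
Proof.
  intros [Hk Hk1 E] [Hm M2 M1].
  pose proof (fun s => lambda_sqr a b c (k s) (k1 s) (E s)) as L2.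
  set (lam := lambda a b c) in *; clearbody lam; clear E c.
  (* The derivative of [rate_x2]. *)
  assert (M3 : forall s, mu1 s * (lax3 b (k s) + lam) = k1 s * (k s - 2 * mu s)).
  { intros s.
    assert (D1 : is_derive (fun t => mu t * (lax3 b (k t) + lam)) s
                   (mu1 s * (lax3 b (k s) + lam) + mu s * (2 * k1 s))).
    { unfold lax3; auto_derive; [ repeat split; eexists; eauto | eta_Derive ].
      rewrite (is_derive_unique _ _ _ (Hk s)), (is_derive_unique _ _ _ (Hm s)); ring. }
    assert (D2 : is_derive (fun t => lax2 a (k t)) s (k s * k1 s)).
    { unfold lax2; auto_derive; [ repeat split; eexists; eauto | eta_Derive ].
      rewrite (is_derive_unique _ _ _ (Hk s)); field. }
    apply (is_derive_ext _ _ s _ M2) in D1.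
    pose proof (eq_trans (eq_sym (is_derive_unique _ _ _ D1)) (is_derive_unique _ _ _ D2)).
    lra. }
  assert (K1 : forall s, - (/ 2 * (k s ^ 3 + 2 * a * k s + b))
                = - 2 * lax3 b (k s) - k s * lax2 a (k s)).
  { intros s; unfold lax2, lax3; field. }
  split.
  - intros s; eapply is_cderive_eq.
    + apply (is_cderive_pair (fun t => lax3 b (k t) + lam) (fun _ => 0) s (2 * k1 s) 0).
      * unfold lax3; auto_derive; [ repeat split; eexists; eauto | eta_Derive ].
        rewrite (is_derive_unique _ _ _ (Hk s)); ring.
      * exact (is_derive_const _ _).
    + specialize (M2 s).
      apply injective_projections; simpl; lra.
  - intros s; eapply is_cderive_eq.
    + apply (is_cderive_pair k1 (fun t => - lax2 a (k t)) s _ (- (k s * k1 s)) (Hk1 s)).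
      unfold lax2; auto_derive; [ repeat split; eexists; eauto | eta_Derive ].
      rewrite (is_derive_unique _ _ _ (Hk s)); field.
    + rewrite K1; specialize (M2 s).
      apply injective_projections; simpl; lra.
  - intros s; eapply is_cderive_eq.
    + apply (is_cderive_pair (fun t => lam - lax3 b (k t) - 2 * mu t * lax2 a (k t))
         (fun t => - (2 * mu t * k1 t)) s
         (- 2 * k1 s - 2 * (mu1 s * lax2 a (k s) + mu s * (k s * k1 s)))
         (- (2 * (mu1 s * k1 s + mu s * (- 2 * lax3 b (k s) - k s * lax2 a (k s)))))).
      * unfold lax2, lax3; auto_derive; [ repeat split; eexists; eauto | eta_Derive ].
        rewrite (is_derive_unique _ _ _ (Hk s)), (is_derive_unique _ _ _ (Hm s)); field.
      * rewrite <- K1.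
        auto_derive; [ repeat split; eexists; eauto | eta_Derive ].
        rewrite (is_derive_unique _ _ _ (Hk1 s)), (is_derive_unique _ _ _ (Hm s)); field.
    + specialize (M1 s); specialize (M2 s); specialize (M3 s).
      assert (M4 : mu1 s * lax2 a (k s) = mu s * (k1 s * (k s - 2 * mu s)))
        by (rewrite <- M2, <- M3; ring).
      rewrite M1, M4.
      apply injective_projections; simpl.
      * ring.
      * replace (lam * mu s) with (lax2 a (k s) - mu s * lax3 b (k s)) by lra.
        rewrite <- M2; ring.
  - intros s; specialize (L2 s); specialize (M2 s).
    apply injective_projections; simpl.
    + transitivity (lam ^ 2 - lax3 b (k s) ^ 2
          - 2 * lax2 a (k s) * (mu s * (lax3 b (k s) + lam))); [ ring |].
      rewrite M2, L2; ring.
    + transitivity (- 2 * k1 s * (mu s * (lax3 b (k s) + lam))); [ ring |].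
      rewrite M2; ring.
Qed.

(** The contraction of the tensor square with the product of two solutions.
    When [p r = q^2] it is, up to the factor [p], the product of their Hermitian
    products with the eigenvector ([pairing_square]). *)
Definition pairing (p q r u u1 v v1 : C) : C :=
  (p * (u * v) + q * (u * v1 + u1 * v) + r * (u1 * v1))%C.

(** The linear equation is skew-Hermitian, so Hermitian products of solutions
    are constant, and so are their tensor squares. *)
Lemma pairing_constant (k mu th : R -> R) (p q r u u1 v v1 : R -> C) :
  weights k mu p q r -> (forall s, is_derive th s (mu s)) ->
  solution k u u1 -> solution k v v1 ->
  forall s t,
  (cis (- 2 * th s) * pairing (p s) (q s) (r s) (u s) (u1 s) (v s) (v1 s)
   = cis (- 2 * th t) * pairing (p t) (q t) (r t) (u t) (u1 t) (v t) (v1 t))%C.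
Proof.
  intros [Wp Wq Wr _] Hth Hu Hv.
  apply (cderive_0_constant (fun s => cis (- 2 * th s)
    * pairing (p s) (q s) (r s) (u s) (u1 s) (v s) (v1 s))%C).
  intros s; destruct (Hu s) as [Du Du1]; destruct (Hv s) as [Dv Dv1].
  assert (D2 : is_derive (fun s => - 2 * th s) s (- 2 * mu s))
    by (apply (is_derive_scal th), Hth).
  pose proof (is_cderive_mult _ _ _ _ _ (is_cderive_cis _ _ _ D2)
    (is_cderive_plus _ _ _ _ _ (is_cderive_plus _ _ _ _ _
      (is_cderive_mult _ _ _ _ _ (Wp s) (is_cderive_mult _ _ _ _ _ Du Dv))
      (is_cderive_mult _ _ _ _ _ (Wq s)
        (is_cderive_plus _ _ _ _ _ (is_cderive_mult _ _ _ _ _ Du Dv1)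
          (is_cderive_mult _ _ _ _ _ Du1 Dv))))
      (is_cderive_mult _ _ _ _ _ (Wr s) (is_cderive_mult _ _ _ _ _ Du1 Dv1)))) as D.
  apply (is_cderive_eq _ _ _ _ D).
  replace (RtoC (- 2 * mu s)) with (- (mu s + mu s))%C
    by (apply injective_projections; simpl; ring).
  ring.
Qed.

Lemma pairing_square (p q r u u1 v v1 : C) :
  (p * r = q * q -> p * pairing p q r u u1 v v1 = (p * u + q * u1) * (p * v + q * v1))%C.
Proof.
  intros H; unfold pairing.
  transitivity (p * p * (u * v) + p * q * (u * v1 + u1 * v) + p * r * (u1 * v1))%C;
    [ | rewrite H ]; ring.
Qed.

(** The trace of the linear equation is [i k]. *)
Lemma wronskian_phase (k ka : R -> R) (x x1 y y1 : R -> C) :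
  solution k x x1 -> solution k y y1 -> (forall s, is_derive ka s (k s)) ->
  forall s t, (cis (- ka s) * wronskian x x1 y y1 s
             = cis (- ka t) * wronskian x x1 y y1 t)%C.
Proof.
  intros Hx Hy Hka.
  apply (cderive_0_constant (fun s => cis (- ka s) * wronskian x x1 y y1 s)%C).
  intros s; destruct (Hx s) as [Dx Dx1]; destruct (Hy s) as [Dy Dy1].
  assert (D2 : is_derive (fun s => - ka s) s (- k s))
    by (apply (is_derive_opp ka), Hka).
  pose proof (is_cderive_mult _ _ _ _ _ (is_cderive_cis _ _ _ D2)
    (is_cderive_minus _ _ _ _ _ (is_cderive_mult _ _ _ _ _ Dx Dy1)
      (is_cderive_mult _ _ _ _ _ Dy Dx1))) as D.
  apply (is_cderive_eq _ _ _ _ D).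
  rewrite RtoC_opp; unfold wronskian; ring.
Qed.

Lemma same_squares_sign (a b a' b' : C) :
  (a' * a' = a * a -> a' * b' = a * b -> b' * b' = b * b ->
   exists e : C, e * e = 1 /\ a' = e * a /\ b' = e * b)%C.
Proof.
  intros Haa Hab Hbb.
  assert (S : forall z z' : C, (z' * z' = z * z -> exists e : C, e * e = 1 /\ z' = e * z)%C).
  { intros z z' H.
    assert (Z : ((z' - z) * (z' + z) = 0)%C)
      by (transitivity (z' * z' - z * z)%C; [| rewrite H ]; ring).
    destruct (Ceq_dec (z' - z)%C 0%C) as [Z0 | Z0].
    - exists 1%C; split; [ ring |].
      transitivity ((z' - z) + z)%C; [| rewrite Z0 ]; ring.
    - exists (- (1))%C; split; [ ring |].
      assert (Z1 : (z' + z = 0)%C).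
      { transitivity (/ (z' - z) * ((z' - z) * (z' + z)))%C;
          [ field; exact Z0 | rewrite Z; ring ]. }
      transitivity ((z' + z) - z)%C; [| rewrite Z1 ]; ring. }
  destruct (Ceq_dec a 0%C) as [Za | Na].
  - destruct (S b b' Hbb) as [e [He Hb]]; exists e; repeat split; trivial.
    destruct (S a a' Haa) as [e' [_ ->]]; rewrite Za; ring.
  - destruct (S a a' Haa) as [e [He Ha]]; exists e; repeat split; trivial.
    transitivity (/ a * (e * (e * a * b')))%C.
    + transitivity (e * e * b')%C; [ rewrite He; ring | field; exact Na ].
    + rewrite <- Ha, Hab; field; exact Na.
Qed.

(** * Monodromy *)

Lemma weighted_norm_neq_0 (p q : C) :
  Cconj p = p -> p <> 0%C -> (p * p + q * Cconj q)%C <> 0%C.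
Proof.
  intros Hp Np E; apply Np.
  apply (f_equal snd) in Hp; apply (f_equal fst) in E.
  destruct p as [p p'], q as [q q']; simpl in *.
  assert (Z : p' = 0) by lra; subst p'.
  pose proof (pow2_ge_0 p); pose proof (pow2_ge_0 q); pose proof (pow2_ge_0 q').
  apply injective_projections; simpl; nra.
Qed.

(** The products [g], [h] of the coordinates with an eigenvector, together with
    the determinant of the unitary frame, recover the curve: the component
    along the orthogonal eigenvector is fixed by the determinant. *)
Lemma frame_reconstruct (k : R -> R) (x x1 y y1 : R -> C) (p q : C) (s : R) :
  moving_frame k x x1 y y1 -> Cconj p = p ->
  let d := wronskian x x1 y y1 s in
  let g := (p * x s + q * x1 s)%C in
  let h := (p * y s + q * y1 s)%C in
  ((p * p + q * Cconj q) * x s = p * g + q * d * Cconj h /\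
   (p * p + q * Cconj q) * y s = p * h - q * d * Cconj g)%C.
Proof.
  intros F Hp; cbv zeta.
  pose proof (frame_wronskian_unit _ _ _ _ _ F s) as U.
  rewrite (frame_x1E _ _ _ _ _ F s), (frame_y1E _ _ _ _ _ F s).
  set (d := wronskian x x1 y y1 s) in *.
  rewrite !Cplus_conj, !Cmult_conj, Copp_conj, !Cmult_conj, !Cconj_conj, Hp.
  split.
  - transitivity (p * p * x s + q * Cconj q * x s * (d * Cconj d))%C;
      [ rewrite U |]; ring.
  - transitivity (p * p * y s + q * Cconj q * y s * (d * Cconj d))%C;
      [ rewrite U |]; ring.
Qed.

(** [ka] and [th] are the primitives of [k] and [mu], [T] is a common period of
    the coefficients and [s0] a point where the eigenvector does not
    degenerate. *)
Record monodromy_data (k mu ka th : R -> R) (x x1 y y1 p q r : R -> C) (T s0 : R) : Prop := {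
  mono_frame : moving_frame k x x1 y y1;
  mono_weights : weights k mu p q r;
  mono_ka : forall s, is_derive ka s (k s);
  mono_th : forall s, is_derive th s (mu s);
  mono_real : forall s, Cconj (p s) = p s;
  mono_k : forall s, k (s + T) = k s;
  mono_p : forall s, p (s + T) = p s;
  mono_q : forall s, q (s + T) = q s;
  mono_r : forall s, r (s + T) = r s;
  mono_ka_shift : forall s, ka (s + T) = ka s + ka T;
  mono_th_shift : forall s, th (s + T) = th s + th T;
  mono_p0 : p s0 <> 0%C
}.

Lemma Cmult_eq_reg_l (z u v : C) : z <> 0%C -> (z * u = z * v)%C -> u = v.
Proof.
  intros N H; transitivity (/ z * (z * u))%C; [ field; exact N |].
  rewrite H; field; exact N.
Qed.

(** Over a period of the curve the conserved quantities of
    [wronskian_phase] and [pairing_constant] return with an extra phase, which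
    must be trivial since they do not vanish: the products of both coordinates
    with the eigenvector at [s0] cannot be zero by [frame_reconstruct]. *)
Lemma closed_phases (k mu ka th : R -> R) (x x1 y y1 p q r : R -> C) (T s0 : R) :
  monodromy_data k mu ka th x x1 y y1 p q r T s0 ->
  x (s0 + T) = x s0 -> x1 (s0 + T) = x1 s0 ->
  y (s0 + T) = y s0 -> y1 (s0 + T) = y1 s0 ->
  cis (- ka T) = 1%C /\ cis (- 2 * th T) = 1%C.
Proof.
  intros [F W Hka Hth Hp Tk Tp Tq Tr Ska Sth N] Ex Ex1 Ey Ey1.
  pose proof (frame_x _ _ _ _ _ F) as Sx; pose proof (frame_y _ _ _ _ _ F) as Sy.
  split.
  - pose proof (wronskian_phase _ _ _ _ _ _ Sx Sy Hka (s0 + T) s0) as D.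
    unfold wronskian in D; rewrite Ex, Ex1, Ey, Ey1, Ska in D.
    fold (wronskian x x1 y y1 s0) in D.
    rewrite Ropp_plus_distr, cis_plus in D.
    apply (Cmult_eq_reg_l (cis (- ka s0) * wronskian x x1 y y1 s0)).
    + apply Cmult_neq_0; [ apply cis_neq_0 |]; intros Z.
      pose proof (frame_wronskian_unit _ _ _ _ _ F s0) as U; rewrite Z in U.
      apply (f_equal fst) in U; simpl in U; lra.
    + transitivity (cis (- ka s0) * wronskian x x1 y y1 s0)%C; [| ring ].
      etransitivity; [| exact D ]; ring.
  - assert (S : forall u u1, solution k u u1 -> u (s0 + T) = u s0 -> u1 (s0 + T) = u1 s0 ->
      (p s0 * u s0 + q s0 * u1 s0 <> 0)%C -> cis (- 2 * th T) = 1%C).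
    { intros u u1 Su Eu Eu1 G.
      pose proof (pairing_constant _ _ _ _ _ _ _ _ _ _ W Hth Su Su (s0 + T) s0) as D.
      rewrite Tp, Tq, Tr, Eu, Eu1, Sth in D.
      pose proof (pairing_square _ _ _ (u s0) (u1 s0) (u s0) (u1 s0)
                    (weights_square _ _ _ _ _ W s0)) as Q.
      set (B := pairing _ _ _ _ _ _ _) in *.
      replace (- 2 * (th s0 + th T)) with (- 2 * th s0 + - 2 * th T) in D by ring.
      rewrite cis_plus in D.
      apply (Cmult_eq_reg_l (cis (- 2 * th s0) * B)).
      - apply Cmult_neq_0; [ apply cis_neq_0 |]; intros Z; rewrite Z in Q.
        apply (Cmult_neq_0 _ _ G G); rewrite <- Q; ring.
      - transitivity (cis (- 2 * th s0) * B)%C; [| ring ].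
        etransitivity; [| exact D ]; ring. }
    destruct (Ceq_dec (p s0 * x s0 + q s0 * x1 s0)%C 0%C) as [Zx | Nx];
      [| now apply (S x x1) ].
    destruct (Ceq_dec (p s0 * y s0 + q s0 * y1 s0)%C 0%C) as [Zy | Ny];
      [| now apply (S y y1) ].
    exfalso.
    destruct (frame_reconstruct _ _ _ _ _ (p s0) (q s0) s0 F (Hp s0)) as [Rx Ry].
    assert (C0 : Cconj 0 = 0%C) by (apply injective_projections; simpl; ring).
    cbv zeta in Rx, Ry; rewrite Zx, Zy, C0 in Rx, Ry.
    pose proof (weighted_norm_neq_0 _ (q s0) (Hp s0) N) as Nn.
    assert (X : x s0 = 0%C) by (apply (Cmult_eq_reg_l _ _ _ Nn); rewrite Rx; ring).
    assert (Y : y s0 = 0%C) by (apply (Cmult_eq_reg_l _ _ _ Nn); rewrite Ry; ring).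
    pose proof (frame_unit _ _ _ _ _ F s0) as U; rewrite X, Y in U.
    apply (f_equal fst) in U; simpl in U; lra.
Qed.

(** Trivial phases leave the determinant and the squares of the products with
    the eigenvector at [s0] unchanged, so the products change by a common sign
    [e].  The reconstruction is linear in these products, so the whole frame at
    [s0] is multiplied by [e], and uniqueness of solutions carries this to every
    parameter. *)
Lemma phases_closed (k mu ka th : R -> R) (x x1 y y1 p q r : R -> C) (T s0 : R) :
  monodromy_data k mu ka th x x1 y y1 p q r T s0 ->
  cis (- ka T) = 1%C -> cis (- 2 * th T) = 1%C ->
  exists e : C, (e * e = 1)%C /\
    forall s, x (s + T) = (e * x s)%C /\ y (s + T) = (e * y s)%C.
Proof.
  intros [F W Hka Hth Hp Tk Tp Tq Tr Ska Sth N] C1 C2.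
  pose proof (frame_x _ _ _ _ _ F) as Sx; pose proof (frame_y _ _ _ _ _ F) as Sy.
  assert (S : forall u u1 v v1, solution k u u1 -> solution k v v1 ->
      ((p s0 * u (s0 + T)%R + q s0 * u1 (s0 + T)%R)
        * (p s0 * v (s0 + T)%R + q s0 * v1 (s0 + T)%R)
       = (p s0 * u s0 + q s0 * u1 s0) * (p s0 * v s0 + q s0 * v1 s0))%C).
  { intros u u1 v v1 Su Sv.
    rewrite <- !(pairing_square _ _ (r s0)) by apply (weights_square _ _ _ _ _ W).
    f_equal; apply (Cmult_eq_reg_l (cis (- 2 * th s0))); [ apply cis_neq_0 |].
    rewrite <- (pairing_constant _ _ _ _ _ _ _ _ _ _ W Hth Su Sv (s0 + T) s0).
    rewrite Tp, Tq, Tr, Sth.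
    replace (- 2 * (th s0 + th T)) with (- 2 * th s0 + - 2 * th T) by ring.
    rewrite cis_plus, C2; ring. }
  destruct (same_squares_sign _ _ _ _ (S _ _ _ _ Sx Sx) (S _ _ _ _ Sx Sy)
              (S _ _ _ _ Sy Sy)) as [e [He [Gx Gy]]].
  exists e; split; trivial.
  assert (D : wronskian x x1 y y1 (s0 + T) = wronskian x x1 y y1 s0).
  { apply (Cmult_eq_reg_l (cis (- ka s0))); [ apply cis_neq_0 |].
    rewrite <- (wronskian_phase _ _ _ _ _ _ Sx Sy Hka (s0 + T) s0), Ska.
    rewrite Ropp_plus_distr, cis_plus, C1; ring. }
  assert (Hc : Cconj e = e).
  { destruct e as [e e']; apply (f_equal fst) in He as E1; apply (f_equal snd) in He as E2.
    simpl in E1, E2.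
    assert (Z : e' = 0) by (pose proof (pow2_ge_0 e); pose proof (pow2_ge_0 e'); nra).
    rewrite Z; apply injective_projections; simpl; ring. }
  destruct (frame_reconstruct _ _ _ _ _ (p s0) (q s0) s0 F (Hp s0)) as [Rx Ry].
  destruct (frame_reconstruct _ _ _ _ _ (p s0) (q s0) (s0 + T) F (Hp s0)) as [Rx' Ry'].
  cbv zeta in *; rewrite Gx, Gy, D in Rx', Ry'.
  rewrite Cmult_conj, Hc in Rx', Ry'.
  pose proof (weighted_norm_neq_0 _ (q s0) (Hp s0) N) as Nn.
  assert (X : x (s0 + T) = (e * x s0)%C).
  { apply (Cmult_eq_reg_l _ _ _ Nn); rewrite Rx'.
    transitivity (e * ((p s0 * p s0 + q s0 * Cconj (q s0)) * x s0))%C;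
      [ rewrite Rx |]; ring. }
  assert (Y : y (s0 + T) = (e * y s0)%C).
  { apply (Cmult_eq_reg_l _ _ _ Nn); rewrite Ry'.
    transitivity (e * ((p s0 * p s0 + q s0 * Cconj (q s0)) * y s0))%C;
      [ rewrite Ry |]; ring. }
  assert (X1 : x1 (s0 + T) = (e * x1 s0)%C).
  { rewrite !(frame_x1E _ _ _ _ _ F), D, Y, Cmult_conj, Hc; ring. }
  assert (Y1 : y1 (s0 + T) = (e * y1 s0)%C).
  { rewrite !(frame_y1E _ _ _ _ _ F), D, X, Cmult_conj, Hc; ring. }
  assert (Q : forall u u1, solution k u u1 -> u (s0 + T) = (e * u s0)%C ->
     u1 (s0 + T) = (e * u1 s0)%C -> forall s, u (s + T) = (e * u s)%C).
  { intros u u1 Su Eu Eu1 s.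
    assert (Z : (u (s + T)%R - e * u s = 0)%C).
    { apply (solution_unique k (fun t => u (t + T)%R - e * u t)%C
               (fun t => u1 (t + T)%R - e * u1 t)%C s0).
      - intros t; destruct (Su t) as [D0 D1]; destruct (Su (t + T)) as [D0' D1'].
        split; eapply is_cderive_eq.
        + apply is_cderive_minus; [ apply is_cderive_shift, D0' |].
          apply is_cderive_mult; [ apply is_cderive_const | exact D0 ].
        + cbv beta; ring.
        + apply is_cderive_minus; [ apply is_cderive_shift, D1' |].
          apply is_cderive_mult; [ apply is_cderive_const | exact D1 ].
        + cbv beta; rewrite Tk; ring.
      - rewrite Eu; ring.
      - rewrite Eu1; ring. }
    transitivity (u (s + T)%R - e * u s + e * u s)%C; [| rewrite Z ]; ring. }
  intros s; split; [ now apply (Q x x1) | now apply (Q y y1) ].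
Qed.

(** * Rationality *)

Lemma rational_iff (x : R) :
  rational x <-> exists (n : nat) (m : Z), (0 < n)%nat /\ INR n * x = IZR m.
Proof.
  split.
  - intros [[m d] ->]; exists (Pos.to_nat d), m; split; [ lia |].
    unfold Q2R; simpl; rewrite INR_IPR; change (IPR d) with (IZR (Zpos d)).
    field; apply not_0_IZR; lia.
  - intros [n [m [Hn H]]]; exists (QArith_base.Qmake m (Pos.of_nat n)).
    assert (Nn : INR n <> 0) by (apply not_0_INR; lia).
    unfold Q2R; simpl.
    replace (IZR (Z.pos (Pos.of_nat n))) with (INR n).
    + rewrite <- H; field; exact Nn.
    + rewrite INR_IZR_INZ; f_equal; lia.
Qed.

Lemma period_multiple {A : Type} (f : R -> A) (w T : R) :
  least_period f w -> period f T -> exists n : nat, (0 < n)%nat /\ T = INR n * w.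
Proof.
  intros [[Hw Pw] Least] [HT PT].
  destruct (nfloor_ex (T / w)) as [n [H1 H2]].
  { apply Rlt_le, Rdiv_lt_0_compat; assumption. }
  assert (L : INR n * w <= T).
  { apply Rle_trans with (T / w * w); [ nra | right; field; lra ]. }
  assert (U : T < (INR n + 1) * w).
  { apply Rle_lt_trans with (T / w * w); [ right; field; lra | nra ]. }
  assert (E : T = INR n * w).
  { destruct (Rle_lt_or_eq_dec _ _ L) as [Lt | Eq]; [ exfalso | auto ].
    assert (P' : period f (T - INR n * w)).
    { split; [ lra | intros s ].
      rewrite <- (shift_INR f w Pw n), <- (PT s); f_equal; ring. }
    specialize (Least _ P'); lra. }
  exists n; split; trivial.
  destruct n as [| n]; [ simpl in E; lra | lia ].
Qed.

(** * Closed curves *)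

Lemma modulus_flow (k : R -> R) (a b c e1 e2 e3 : R) :
  rsmooth k -> has_modulus k a b c e1 e2 e3 -> quartic_flow a b c k (Derive k).
Proof.
  intros Sk [H2 [H1 _]]; split.
  - intros s; apply Derive_correct, rsmooth_ex_derive, Sk.
  - intros s; apply (is_derive_eq _ _ (Derive_n k 2 s)).
    + apply Derive_correct, (rsmooth_ex_derive _ (rsmooth_Derive _ Sk)).
    + specialize (H2 s); lra.
  - exact H1.
Qed.

Lemma least_period_not_constant (f : R -> R) (w : R) :
  least_period f w -> ~ forall s t, f s = f t.
Proof.
  intros [[Hw _] Least] H.
  assert (w <= w / 2) by (apply Least; split; [ lra | intros; apply H ]); lra.
Qed.

Lemma exists_regular_point (b lam w : R) (k : R -> R) :
  least_period k w -> exists s0, weight_p b lam (k s0) <> 0%C.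
Proof.
  intros Hw; apply NNPP; intros H; apply (least_period_not_constant _ _ Hw).
  assert (Z : forall s, lax3 b (k s) + lam = 0).
  { intros s; apply NNPP; intros Z; apply H; exists s; intros E; apply Z.
    exact (f_equal fst E). }
  intros s t; pose proof (Z s); pose proof (Z t); unfold lax3 in *; lra.
Qed.

Lemma Phi2_phase (a b c w : R) (k mu : R -> R) :
  (forall s, continuous k s) -> (forall s, continuous mu s) ->
  (forall s, Lambda a b c k s = / 4 * k s - mu s) ->
  integral0 mu w = 2 * PI * (/ 4 * Phi1 k w - Phi2 a b c k w).
Proof.
  intros Ck Cm E; pose proof PI_RGT_0.
  assert (I : RInt (Lambda a b c k) 0 w = / 4 * integral0 k w - integral0 mu w).
  { rewrite (RInt_ext _ (fun s => minus (scal (/ 4) (k s)) (mu s)));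
      [| intros; apply E ].
    assert (X : forall f : R -> R, (forall s, continuous f s) -> ex_RInt f 0 w).
    { intros f Hf; apply (ex_RInt_continuous (V := R_CompleteNormedModule)); auto. }
    rewrite (RInt_minus (fun s => scal (/ 4) (k s)) mu);
      [| apply (ex_RInt_scal k), X, Ck | apply X, Cm ].
    rewrite (RInt_scal k); [ reflexivity | apply X, Ck ]. }
  unfold Phi1, Phi2; rewrite I; fold (integral0 k w); field; lra.
Qed.

(** The factor [/ 4] and the doubled angle mix the two conditions, but only by
    rational coefficients. *)
Lemma quasi_periods_rational (f1 f2 : R) :
  rational f1 /\ rational f2 <->
  exists n : nat, (0 < n)%nat /\
    cis (- (INR n * (2 * PI * f1))) = 1%C /\
    cis (- 2 * (INR n * (2 * PI * (/ 4 * f1 - f2)))) = 1%C.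
Proof.
  pose proof PI_RGT_0 as HP; rewrite !rational_iff; split.
  - intros [[n1 [m1 [N1 H1]]] [n2 [m2 [N2 H2]]]].
    (* The factor 2 clears the denominator of [2 * (/ 4)]. *)
    exists (2 * n1 * n2)%nat; split; [ lia |].
    rewrite !mult_INR; simpl (INR 2); split; apply cis_eq_1.
    + exists (- (2 * Z.of_nat n2 * m1))%Z.
      rewrite opp_IZR, !mult_IZR, <- H1, <- INR_IZR_INZ; ring.
    + exists (- (Z.of_nat n2 * m1 - 4 * Z.of_nat n1 * m2))%Z.
      rewrite opp_IZR, minus_IZR, !mult_IZR, <- H1, <- H2, <- !INR_IZR_INZ; field.
  - intros [n [Hn [H1 H2]]].
    apply cis_eq_1 in H1; apply cis_eq_1 in H2.
    destruct H1 as [m1 H1], H2 as [m2 H2].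
    assert (E1 : INR n * f1 = - IZR m1).
    { apply (Rmult_eq_reg_r (2 * PI)); lra. }
    assert (E2 : 4 * INR n * f2 = INR n * f1 + 2 * IZR m2).
    { apply (Rmult_eq_reg_r PI); lra. }
    split.
    + exists n, (- m1)%Z; split; [ exact Hn |]; rewrite opp_IZR; exact E1.
    + exists (4 * n)%nat, (2 * m2 - m1)%Z; split; [ lia |].
      rewrite mult_INR, minus_IZR, mult_IZR; simpl (INR 4).
      replace (2 + 1 + 1) with 4 by ring; lra.
Qed.

Theorem proposition4p3 :
  forall (gamma gamma0 : R -> C2) (a b c e1 e2 e3 omega : R),
    s_curve gamma ->
    reparametrization gamma gamma0 ->
    let k := curvature gamma0 in
    has_modulus k a b c e1 e2 e3 ->
    least_period k omega ->
    (periodic gamma <-> rational (Phi1 k omega) /\ rational (Phi2 a b c k omega)).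
Proof.
  intros gamma gamma0 a b c e1 e2 e3 omega [Leg _] Rep k Mod Least.
  destruct (reparametrization_affine _ _ Rep) as [t0 [e [He E0]]].
  rewrite (periodic_affine gamma gamma0 t0 e He E0).
  pose proof (legendrian_affine _ _ _ _ He E0 Leg) as Leg0.
  clear gamma Leg Rep E0 He.
  pose proof (rsmooth_curvature _ (proj1 Leg0)) as Sk; fold k in Sk.
  pose proof (modulus_flow _ _ _ _ _ _ _ Sk Mod) as Flow.
  destruct (exists_phase_rate a b c e1 e2 e3 k (Derive k) Flow (proj1 (proj2 (proj2 Mod))))
    as [F [mu1 [Rate HL]]].
  set (mu := fun s => F (k s)) in *.
  assert (Ck : forall s, continuous k s).
  { intros s; apply (ex_derive_continuous k s), rsmooth_ex_derive, Sk. }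
  assert (Cm : forall s, continuous mu s).
  { intros s; apply (ex_derive_continuous mu s); eexists; apply (rate_derive _ _ _ _ _ _ _ Rate). }
  pose proof (legendrian_frame _ Leg0) as Fr; fold k in Fr.
  pose proof (flow_weights _ _ _ _ _ _ _ Flow Rate) as W.
  destruct (exists_regular_point b (lambda a b c) omega k Least) as [s0 N].
  assert (Data : forall n : nat, monodromy_data k mu (integral0 k) (integral0 mu)
    (fun s => fst (gamma0 s)) (fun s => fst (C2Derive gamma0 s))
    (fun s => snd (gamma0 s)) (fun s => snd (C2Derive gamma0 s))
    (fun s => weight_p b (lambda a b c) (k s))
    (fun s => weight_q a (k s) (Derive k s))
    (fun s => weight_r a b (lambda a b c) (k s) (Derive k s) (mu s))
    (INR n * omega) s0).
  { intros n.
    pose proof (shift_INR k omega (proj2 (proj1 Least)) n) as Tk.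
    pose proof (periodic_Derive k _ Tk) as Tk1.
    assert (Tm : forall s, mu (s + INR n * omega) = mu s)
      by (intros s; unfold mu; now rewrite Tk).
    split; [ exact Fr | exact W | now apply integral0_derive | now apply integral0_derive
           | | exact Tk | | | | now apply integral0_shift | now apply integral0_shift
           | exact N ]; intros s; cbv beta; rewrite ?Tm, ?Tk1, ?Tk; try reflexivity.
    apply injective_projections; simpl; ring. }
  assert (K : forall n : nat, integral0 k (INR n * omega) = INR n * (2 * PI * Phi1 k omega)).
  { intros n; rewrite (integral0_INR k omega Ck (proj2 (proj1 Least))).
    pose proof PI_RGT_0; unfold Phi1; fold (integral0 k omega); field; lra. }
  assert (M : forall n : nat, integral0 mu (INR n * omega)
     = INR n * (2 * PI * (/ 4 * Phi1 k omega - Phi2 a b c k omega))).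
  { intros n; rewrite (integral0_INR mu omega Cm).
    - now rewrite (Phi2_phase a b c omega k mu Ck Cm HL).
    - intros s; unfold mu; now rewrite (proj2 (proj1 Least)). }
  rewrite quasi_periods_rational; split.
  - intros [T PT].
    destruct (period_multiple k omega T Least (period_curvature _ _ PT)) as [n [Hn ET]].
    exists n; split; [ exact Hn |]; rewrite <- K, <- M.
    pose proof (period_C2Derive _ _ PT) as PT1; rewrite ET in PT, PT1.
    apply (closed_phases _ _ _ _ _ _ _ _ _ _ _ _ _ (Data n));
      now rewrite ?(proj2 PT), ?(proj2 PT1).
  - intros [n [Hn [H1 H2]]]; rewrite <- K in H1; rewrite <- M in H2.
    destruct (phases_closed _ _ _ _ _ _ _ _ _ _ _ _ _ (Data n) H1 H2) as [eps [He S]].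
    pose proof (lt_0_INR n Hn) as Pn; destruct Least as [[Hw _] _].
    (* The curve may change sign after [n] periods of the curvature. *)
    exists (INR n * omega + INR n * omega); split; [ nra |].
    intros s; rewrite <- Rplus_assoc.
    destruct (S (s + INR n * omega)) as [X Y]; destruct (S s) as [X' Y'].
    apply injective_projections; [ rewrite X, X' | rewrite Y, Y' ];
      rewrite Cmult_assoc, He; apply Cmult_1_l.
Qed.
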